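(* Let $\mathcal K\subset\Theta^*$ be the cone of all real $A=(a_{i,j})_{1\le i<j\le n}$ satisfying (a) $a_{i,i+1}+a_{i+1,i+2}\le a_{i,i+2}$ for $1\le i\le n-2$ and (b) $a_{i,j}+a_{i+1,j+1}\le a_{i,j+1}+a_{i+1,j}$ for $1\le i<j-1\le n-2$. The cone $\sigma(\mathcal K)$ consists precisely of those $S=(s_{i_1,\dots,i_k})\in\Xi$ for which $$s_{i_1,\dots,i_k}=\sum_{1\le i<j\le n}T(i_1,\dots,i_k)_{i,j}\,s_{1,\dots,i-1,j}$$ for all tuples $1\le i_1<\dots<i_k\le n$, $1\le k\le n-1$, and (a$'$) $s_{1,\dots,i-1,i+1}+s_{1,\dots,i,i+2}\le s_{1,\dots,i-1,i+2}$ for any $1\le i\le n-2$, (b$'$) $s_{1,\dots,i-1,j}+s_{1,\dots,i,j+1}\le s_{1,\dots,i-1,j+1}+s_{1,\dots,i,j}$ for any $1\le i<j-1\le n-2$.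
   Context: Fix $n\ge2$. $\Theta=\mathbb R^{\{1\le i<j\le n\}}$, and $\Theta^*$ has the dual basis, so its elements are written $A=(a_{i,j})_{1\le i<j\le n}$. $\Xi=\mathbb R^{\{1\le i_1<\dots<i_k\le n\,|\,1\le k\le n-1\}}$. For a tuple $1\le i_1<\dots<i_k\le n$ the vector $T(i_1,\dots,i_k)\in\Theta$ has coordinate $1$ at each pair $(l,i_l)$ with $1\le l\le k$, $i_l>l$, and all other coordinates $0$. The linear map $\sigma:\Theta^*\to\Xi$ is $\sigma(A)_{i_1,\dots,i_k}=A(T(i_1,\dots,i_k))=\sum_{i<j}a_{i,j}T(i_1,\dots,i_k)_{i,j}$. The index $(1,\dots,i-1,j)$ denotes the $i$-element tuple obtained from $(1,\dots,i)$ by replacing $i$ with $j$. *)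

(* Defs.v *)
From HB Require Import structures.
From mathcomp Require Import all_boot all_order all_algebra.
From mathcomp Require Import classical_sets reals.

Set Implicit Arguments.
Unset Strict Implicit.
Unset Printing Implicit Defensive.

Import Order.TTheory GRing.Theory Num.Theory.

Local Open Scope ring_scope.

(* Indices are 1-based: they range over 'I_n.+1 with the value 0 excluded. *)
Definition pair_index (n : nat) : Type :=
  {p : 'I_n.+1 * 'I_n.+1 | (1 <= p.1 < p.2)%N}.

(* [path ltn 0 s] says 0 < i_1 < ... < i_k; the bounded-sequence type gives
   k <= n - 1. *)
Definition tuple_index (n : nat) : Type :=
  {s : (n.-1).-bseq 'I_n.+1 |
    (1 <= size s)%N && path ltn 0%N [seq val x | x <- s]}.

Definition row_of n (p : pair_index n) : nat := (val p).1.
Definition col_of n (p : pair_index n) : nat := (val p).2.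
Definition seq_of n (t : tuple_index n) : seq nat := [seq val x | x <- val t].

Notation Theta R n := {ffun pair_index n -> R^o}.
Notation ThetaDual R n := 'Hom(Theta R n, R^o).
Notation Xi R n := {ffun tuple_index n -> R^o}.

(* The basis vector of Theta at the pair (i, j), meaningful for
   1 <= i < j <= n. *)
Definition basis_vec (R : realType) (n i j : nat) : Theta R n :=
  [ffun p => ((row_of p == i) && (col_of p == j))%:R].

(* The coordinate a_{i,j} of A in the dual basis. *)
Definition dual_coord (R : realType) (n : nat) (A : ThetaDual R n)
  (i j : nat) : R := A (basis_vec R n i j).

(* The requirement i_l > l is built into [pair_index]. *)
Definition Tvec (R : realType) (n : nat) (t : tuple_index n) : Theta R n :=
  [ffun p => ((row_of p <= size (seq_of t))%N &&
              (nth 0%N (seq_of t) (row_of p).-1 == col_of p))%:R].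

Definition sigma (R : realType) (n : nat) (A : ThetaDual R n) : Xi R n :=
  [ffun t => A (Tvec R t)].

(* The coordinate s_{i_1,...,i_k} for a sequence of natural numbers; the
   value 0 is returned only if the sequence is not an element of
   [tuple_index n]. *)
Definition xi_coord (R : realType) (n : nat) (S : Xi R n) (s : seq nat) : R :=
  if [pick t | seq_of t == s] is Some t then S t else 0.

(* The tuple (1, ..., i-1, j). *)
Definition prefix_seq (i j : nat) : seq nat := rcons (iota 1 i.-1) j.

Definition coneK (R : realType) (n : nat) : set (ThetaDual R n) :=
  fun A =>
    (forall i : nat, (1 <= i <= n - 2)%N ->
       dual_coord A i i.+1 + dual_coord A i.+1 i.+2 <= dual_coord A i i.+2) /\
    (forall i j : nat, (1 <= i < j - 1)%N -> (j - 1 <= n - 2)%N ->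
       dual_coord A i j + dual_coord A i.+1 j.+1
         <= dual_coord A i j.+1 + dual_coord A i.+1 j).
Arguments coneK : clear implicits.

Lemma sigma_is_linear (R : realType) (n : nat) : linear (@sigma R n).
Proof.
by move=> a A B; apply/ffunP => t; rewrite !ffunE /= !lfunE /= !lfunE.
Qed.
HB.instance Definition _ (R : realType) (n : nat) :=
  GRing.isLinear.Build R (ThetaDual R n) (Xi R n) *:%R (@sigma R n)
    (@sigma_is_linear R n).

Lemma sigma_sumE (R : realType) (n : nat) (A : ThetaDual R n)
    (t : tuple_index n) :
  sigma A t =
  \sum_(p : pair_index n) dual_coord A (row_of p) (col_of p) * Tvec R t p.
Proof.
have decomp (v : Theta R n) :
    v = \sum_p v p *: basis_vec R n (row_of p) (col_of p).
  apply/ffunP => q; rewrite sum_ffunE (bigD1 q) //= !ffunE !eqxx.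
  rewrite big1 ?addr0 => [|p npq]; first by rewrite /GRing.scale /= mulr1.
  rewrite !ffunE; case: andP => [[/eqP e1 /eqP e2]|_]; last exact: mulr0.
  case/eqP: npq; apply/val_inj; move: e1 e2; rewrite /row_of /col_of.
  by case: (val p) (val q) => [a b] [c d] /= /val_inj-> /val_inj->.
rewrite ffunE {1}[Tvec R t]decomp linear_sum; apply: eq_bigr => p _.
by rewrite linearZ /= mulrC.
Qed.

Lemma seq_of_inj n : injective (@seq_of n).
Proof.
by move=> s t /(inj_map val_inj) /val_inj/val_inj.
Qed.

Lemma xi_coordE (R : realType) (n : nat) (S : Xi R n) (t : tuple_index n) :
  xi_coord S (seq_of t) = S t.
Proof.
rewrite /xi_coord; case: pickP => [u /eqP/seq_of_inj->//|/(_ t)].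
by rewrite eqxx.
Qed.

Lemma prefix_seq_index (n i j : nat) : (1 <= i < j)%N -> (j <= n)%N ->
  exists t : tuple_index n, seq_of t = prefix_seq i j.
Proof.
move=> /andP[i0 ij] jn.
set s : seq 'I_n.+1 := [seq inord x | x <- prefix_seq i j].
have es : [seq val x | x <- s] = prefix_seq i j.
  rewrite -map_comp -[RHS]map_id; apply/eq_in_map => x.
  rewrite mem_rcons inE mem_iota => xin; rewrite /= inordK // ltnS.
  case/orP: xin => [/eqP->//|/andP[_]]; rewrite add1n prednK // => xi.
  by rewrite (leq_trans (ltnW xi)) // (leq_trans (ltnW ij)).
have ss : size s = i by rewrite size_map size_rcons size_iota prednK.
have sb : (size s <= n.-1)%N.
  by rewrite ss -ltnS (leq_trans ij) // (leq_trans jn) // leqSpred.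
have sP : (1 <= size (Bseq sb))%N
    && path ltn 0%N [seq val x | x <- Bseq sb].
  rewrite /= ss i0 /= es /prefix_seq rcons_path.
  have /= -> := iota_ltn_sorted 0 i.-1.+1.
  have -> : last 0%N (iota 1 i.-1) = i.-1.
    by case: (i.-1) => // m; rewrite -{1}[m.+1]addn1 iotaD last_cat /= add1n.
  by rewrite /= (leq_ltn_trans (leq_pred i)).
by exists (Sub (Bseq sb) sP : tuple_index n).
Qed.

(* Main.v *)
Require Import Defs.
From HB Require Import structures.
From mathcomp Require Import all_boot all_order all_algebra.
From mathcomp Require Import classical_sets reals zify.

(** The key fact is that the vector T(1, ..., i-1, j) is the standard basis
    vector at (i, j): its l-th entry is l itself for l < i, and such an entry
    contributes no coordinate, so only the last entry j is recorded
    ([Tvec_prefix_seq]).  Hence the coordinates of sigma(A) at the tuples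
    (1, ..., i-1, j) are exactly the a_(i, j) ([xi_coord_sigma]).

    Three consequences give the theorem.  The expansion of sigma(A) in the
    a_(i, j) is the required linear relation on S = sigma(A).  Conversely, the
    relation says that S is the image of the functional whose coordinates are
    read off from S at the tuples (1, ..., i-1, j), so it characterizes the
    range of sigma ([sigma_rangeP]).  Finally, for S = sigma(A) the
    inequalities (a'), (b') are (a), (b) term by term ([coneK_sigma]). *)

Set Implicit Arguments.
Unset Strict Implicit.
Unset Printing Implicit Defensive.

Import Order.TTheory GRing.Theory Num.Theory.

Local Open Scope classical_set_scope.
Local Open Scope ring_scope.

Definition coord_form (R : realType) (n : nat) (c : pair_index n -> R)
  (v : Theta R n) : R^o := \sum_p v p * c p.

Lemma coord_form_is_linear (R : realType) (n : nat) (c : pair_index n -> R) :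
  linear (coord_form c).
Proof.
move=> a u v; rewrite /coord_form /GRing.scale /= mulr_sumr -big_split /=.
by apply: eq_bigr => p _; rewrite !ffunE mulrDl mulrA.
Qed.

HB.instance Definition _ (R : realType) (n : nat) (c : pair_index n -> R) :=
  GRing.isLinear.Build R (Theta R n) R^o *:%R (coord_form c)
    (coord_form_is_linear c).

Lemma nth_prefix_seq (i j l : nat) : (1 <= l <= i)%N ->
  nth 0%N (prefix_seq i j) l.-1 = if l == i then j else l.
Proof.
case: l i => [|l] [|i] //=; rewrite ltnS => li.
rewrite nth_rcons size_iota eqSS.
by case: ltngtP li => // lti _; rewrite nth_iota.
Qed.

(** Entries l < i of (1, ..., i-1, j) sit in position l, whereas an index pair
    at row l has column greater than l: only row i can contribute. *)
Lemma Tvec_prefix_seq (R : realType) (n i j : nat) (t : tuple_index n) :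
  (1 <= i)%N -> seq_of t = prefix_seq i j -> Tvec R t = basis_vec R n i j.
Proof.
move=> i1 et; apply/ffunP => p; rewrite !ffunE et; congr (nat_of_bool _)%:R.
have /andP[r1 rc] : (1 <= row_of p < col_of p)%N := valP p.
have -> : size (prefix_seq i j) = i by rewrite size_rcons size_iota prednK.
case: (leqP (row_of p) i) => [ri|/gtn_eqF -> //] /=.
rewrite nth_prefix_seq ?r1 //.
case: (row_of p =P i) => _ /=; first by rewrite eq_sym.
exact: ltn_eqF.
Qed.

Lemma xi_coord_sigma (R : realType) (n : nat) (A : ThetaDual R n) (i j : nat) :
  (1 <= i < j)%N -> (j <= n)%N ->
  xi_coord (sigma A) (prefix_seq i j) = dual_coord A i j.
Proof.
move=> ij jn; have [t et] := prefix_seq_index ij jn.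
have /andP[i1 _] := ij.
by rewrite -et xi_coordE ffunE (Tvec_prefix_seq R i1 et).
Qed.

(** Under the stated bounds every pair (i, j) in (a) and (b) satisfies
    1 <= i < j <= n, so [xi_coord_sigma] applies to each term. *)
Lemma coneK_sigma (R : realType) (n : nat) (A : ThetaDual R n) :
  coneK R n A <->
  (forall i : nat, (1 <= i <= n - 2)%N ->
     xi_coord (sigma A) (prefix_seq i i.+1)
       + xi_coord (sigma A) (prefix_seq i.+1 i.+2)
       <= xi_coord (sigma A) (prefix_seq i i.+2)) /\
  (forall i j : nat, (1 <= i < j - 1)%N -> (j - 1 <= n - 2)%N ->
     xi_coord (sigma A) (prefix_seq i j)
       + xi_coord (sigma A) (prefix_seq i.+1 j.+1)
       <= xi_coord (sigma A) (prefix_seq i j.+1)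
          + xi_coord (sigma A) (prefix_seq i.+1 j)).
Proof.
split=> -[Ka Kb]; split.
- by move=> i hi; rewrite !xi_coord_sigma ?Ka //; lia.
- by move=> i j hij hj; rewrite !xi_coord_sigma ?Kb //; lia.
- by move=> i hi; have := Ka i hi; rewrite !xi_coord_sigma //; lia.
- by move=> i j hij hj; have := Kb i j hij hj; rewrite !xi_coord_sigma //; lia.
Qed.

(** The relation expresses S through its coordinates at the tuples
    (1, ..., i-1, j); taking these as the a_(i, j) of a functional A turns the
    right-hand side into the expansion of sigma(A). *)
Lemma sigma_rangeP (R : realType) (n : nat) (S : Xi R n) :
  (exists A : ThetaDual R n, sigma A = S) <->
  (forall t : tuple_index n,
     S t = \sum_(p : pair_index n)
             Tvec R t p * xi_coord S (prefix_seq (row_of p) (col_of p))).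
Proof.
split=> [[A <-] t|hS].
  rewrite sigma_sumE; apply: eq_bigr => p _; rewrite mulrC xi_coord_sigma //.
    exact: (valP p).
  by rewrite -ltnS; apply: ltn_ord.
pose c (p : pair_index n) := xi_coord S (prefix_seq (row_of p) (col_of p)).
by exists (linfun (coord_form c)); apply/ffunP => t; rewrite hS ffunE lfunE.
Qed.

Theorem proposition6p5 (R : realType) (n : nat) (hn : (2 <= n)%N) :
  @sigma R n @` coneK R n =
  [set S : Xi R n |
    (forall t : tuple_index n,
       S t = \sum_(p : pair_index n)
               Tvec R t p * xi_coord S (prefix_seq (row_of p) (col_of p))) /\
    (forall i : nat, (1 <= i <= n - 2)%N ->
       xi_coord S (prefix_seq i i.+1) + xi_coord S (prefix_seq i.+1 i.+2)
         <= xi_coord S (prefix_seq i i.+2)) /\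
    (forall i j : nat, (1 <= i < j - 1)%N -> (j - 1 <= n - 2)%N ->
       xi_coord S (prefix_seq i j) + xi_coord S (prefix_seq i.+1 j.+1)
         <= xi_coord S (prefix_seq i j.+1) + xi_coord S (prefix_seq i.+1 j))].
Proof.
apply/seteqP; split=> [S [A KA <-]|S [hS hK]].
  by split; [apply/sigma_rangeP; exists A | apply/coneK_sigma].
have /sigma_rangeP[A eA] := hS.
by exists A => //; apply/coneK_sigma; rewrite eA.
Qed.
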